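(* Let $n,r,m$ be positive integers. Let $A\in\mathbb{R}^{n\times n}$ have all eigenvalues with negative real part, and let $B\in\mathbb{R}^{n\times m}$, $C\in\mathbb{R}^{1\times n}$ and $M\in\mathbb{R}^{n\times n}$ with $M=M^\top$; these define the asymptotically stable system $\dot x=Ax+Bu,\ y=Cx+x^\top Mx$. Let $$\mathcal{M}=\mathrm{Skew}(r)\times\mathrm{Sym}_+(r)\times\mathbb{R}^{r\times m}\times\mathbb{R}^{1\times r}\times\mathrm{Sym}(r)$$ be the product Riemannian manifold with the metric given in the context, and let $f:\mathcal{M}\to\mathbb{R}$ be the squared $H_2$-error cost function given in the context. Let $(\hat J,\hat R,\hat B,\hat C,\hat M)\in\mathcal{M}$, defining the asymptotically stable reduced system $\dot{\hat x}=(\hat J-\hat R)\hat x+\hat Bu,\ \hat y=\hat C\hat x+\hat x^\top\hat M\hat x$. Then the Riemannian gradient of $f$ at $(\hat J,\hat R,\hat B,\hat C,\hat M)$ is $$\mathrm{grad} f=2\left(\mathrm{skew}(K^\top X+L\hat P),\ -\hat R\,\mathrm{sym}(K^\top X+L\hat P)\,\hat R,\ K^\top B+L\hat B,\ \hat C\hat P-CX,\ \hat P\hat M\hat P-X^\top MX\right),$$ where $X\in\mathbb{R}^{n\times r}$ and $\hat P\in\mathbb{R}^{r\times r}$ are the solutions of $$AX+X(\hat J-\hat R)^\top+B\hat B^\top=0,\qquad (\hat J-\hat R)\hat P+\hat P(\hat J-\hat R)^\top+\hat B\hat B^\top=0,$$ and $K\in\mathbb{R}^{n\times r}$ and $L\in\mathbb{R}^{r\times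 r}$ are the solutions of $$A^\top K+K(\hat J-\hat R)-C^\top\hat C-2MX\hat M=0,$$ $$(\hat J-\hat R)^\top L+L(\hat J-\hat R)+\hat C^\top\hat C+2\hat M\hat P\hat M=0.$$
   Context: Notation: $\mathrm{Skew}(r)$, $\mathrm{Sym}(r)$ and $\mathrm{Sym}_+(r)$ denote the real $r\times r$ skew-symmetric, symmetric, and symmetric positive definite matrices respectively. For a square matrix $Z$, $\mathrm{sym}(Z)=\frac{Z+Z^\top}{2}$ and $\mathrm{skew}(Z)=\frac{Z-Z^\top}{2}$. Riemannian structure on $\mathcal{M}$: the tangent space at $x=(\hat J,\hat R,\hat B,\hat C,\hat M)$ is $T_x\mathcal{M}=\mathrm{Skew}(r)\times\mathrm{Sym}(r)\times\mathbb{R}^{r\times m}\times\mathbb{R}^{1\times r}\times\mathrm{Sym}(r)$, and for $\xi=(\xi_J,\xi_R,\xi_B,\xi_C,\xi_M)$, $\eta=(\eta_J,\eta_R,\eta_B,\eta_C,\eta_M)\in T_x\mathcal{M}$ the metric is $$\langle\xi,\eta\rangle_x=\mathrm{tr}(\xi_J^\top\eta_J)+\mathrm{tr}(\hat R^{-1}\xi_R\hat R^{-1}\eta_R)+\mathrm{tr}(\xi_B^\top\eta_B)+\mathrm{tr}(\xi_C\eta_C^\top)+\mathrm{tr}(\xi_M^\top\eta_M).$$ The Riemannian gradient $\mathrm{grad} f(x)$ is the unique element of $T_x\mathcal{M}$ with $Df(x)[\xi]=\langle\mathrm{grad} f(x),\xi\rangle_x$ for all $\xi\in T_x\mathcal{M}$.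 Cost function: $$f(\hat J,\hat R,\hat B,\hat C,\hat M)=\mathrm{tr}\left(B^\top QB+2B^\top Y\hat B+\hat B^\top\hat Q\hat B\right),$$ where $P,Q\in\mathbb{R}^{n\times n}$, $X,Y\in\mathbb{R}^{n\times r}$, $\hat P,\hat Q\in\mathbb{R}^{r\times r}$ are the unique solutions of $$AP+PA^\top+BB^\top=0,\qquad A^\top Q+QA+C^\top C+MPM=0,$$ $$AX+X(\hat J-\hat R)^\top+B\hat B^\top=0,\qquad A^\top Y+Y(\hat J-\hat R)-C^\top\hat C-MX\hat M=0,$$ $$(\hat J-\hat R)\hat P+\hat P(\hat J-\hat R)^\top+\hat B\hat B^\top=0,\qquad (\hat J-\hat R)^\top\hat Q+\hat Q(\hat J-\hat R)+\hat C^\top\hat C+\hat M\hat P\hat M=0.$$ This $f$ is the squared $H_2$-norm $\mathrm{tr}(B_e^\top Q_eB_e)$ of the error system with output $y-\hat y$, where $B_e=\begin{pmatrix}B\\ \hat B\end{pmatrix}$ and $Q_e=\begin{pmatrix}Q&Y\\ Y^\top&\hat Q\end{pmatrix}$. *)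

(* Defs.v *)
From HB Require Import structures.
From mathcomp Require Import all_boot all_order all_algebra.
From mathcomp Require Import all_classical all_reals all_analysis.
From mathcomp.real_closed Require Import complex.

Set Implicit Arguments.
Unset Strict Implicit.
Unset Printing Implicit Defensive.
Import Order.TTheory GRing.Theory Num.Theory.
Import numFieldNormedType.Exports.
Local Open Scope classical_set_scope.
Local Open Scope ring_scope.

Section MatrixNotions.
Context {R : realType}.

Definition sympart (r : nat) (Z : 'M[R]_r) : 'M[R]_r := 2^-1 *: (Z + Z^T).

Definition skewpart (r : nat) (Z : 'M[R]_r) : 'M[R]_r := 2^-1 *: (Z - Z^T).

Definition posdefmx (r : nat) (S : 'M[R]_r) : Prop :=
  S \is symmetricmx /\
  forall v : 'cV[R]_r, v != 0 -> 0 < (v^T *m S *m v) ord0 ord0.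

(* The spectrum is the complex one, so [A] is viewed as a matrix over [R[i]]. *)
Definition hurwitz (n : nat) (A : 'M[R]_n) : Prop :=
  forall z : R[i],
    eigenvalue (map_mx (real_complex R) A) z -> complex.Re z < 0.

(* The solution X of F X + X G + H = 0. It is meant for equations with exactly
   one solution; the value is 0 if there is none. *)
Definition sylvester (p q : nat) (F : 'M[R]_p) (G : 'M[R]_q)
    (H : 'M[R]_(p, q)) : 'M[R]_(p, q) :=
  xget 0 [set X | F *m X + X *m G + H = 0].

End MatrixNotions.

(* Ambient normed space of the tuples (J, R, B, C, M); both the manifold and its
   tangent spaces are subsets of it. *)
Notation params R r m :=
  ('M[R]_r * 'M[R]_r * 'M[R]_(r, m) * 'rV[R]_r * 'M[R]_r)%type.

Section Manifold.
Context {R : realType} {r m : nat}.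
Implicit Types x xi eta g : params R r m.

Definition Jpart x : 'M[R]_r := x.1.1.1.1.
Definition Rpart x : 'M[R]_r := x.1.1.1.2.
Definition Bpart x : 'M[R]_(r, m) := x.1.1.2.
Definition Cpart x : 'rV[R]_r := x.1.2.
Definition Mpart x : 'M[R]_r := x.2.

Definition manifold : set (params R r m) :=
  [set x | [/\ Jpart x \is skewmx, posdefmx (Rpart x)
             & Mpart x \is symmetricmx]].

(* The tangent space does not depend on the base point: the manifold is open in
   this linear subspace. *)
Definition tangent : set (params R r m) :=
  [set xi | [/\ Jpart xi \is skewmx, Rpart xi \is symmetricmx
              & Mpart xi \is symmetricmx]].

Definition metric x xi eta : R :=
  \tr ((Jpart xi)^T *m Jpart eta)
  + \tr (invmx (Rpart x) *m Rpart xi *m invmx (Rpart x) *m Rpart eta)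
  + \tr ((Bpart xi)^T *m Bpart eta)
  + \tr (Cpart xi *m (Cpart eta)^T)
  + \tr ((Mpart xi)^T *m Mpart eta).

(* [D] is the Frechet differential at [x] of the restriction of [f] to the
   manifold: only points [y] of the manifold are considered, so the values of [f]
   elsewhere are irrelevant and [D] is determined on tangent vectors only. *)
Definition is_differential (f : params R r m -> R) x
    (D : {linear params R r m -> R^o}) : Prop :=
  continuous D /\
  forall e : R, 0 < e -> \forall y \near within manifold (nbhs x),
    `|f y - f x - D (y - x)| <= e * `|y - x|.

Definition is_gradient (f : params R r m -> R) x g : Prop :=
  tangent g /\
  exists2 D : {linear params R r m -> R^o}, is_differential f x D &
    forall xi, tangent xi -> D xi = metric x g xi.

End Manifold.

Definition cost {R : realType} {n r m : nat} (A : 'M[R]_n) (B : 'M[R]_(n, m))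
    (C : 'rV[R]_n) (M : 'M[R]_n) (x : params R r m) : R :=
  let Ah := Jpart x - Rpart x in
  let Bh := Bpart x in
  let Ch := Cpart x in
  let Mh := Mpart x in
  let P := sylvester A A^T (B *m B^T) in
  let Q := sylvester A^T A (C^T *m C + M *m P *m M) in
  let X := sylvester A Ah^T (B *m Bh^T) in
  let Y := sylvester A^T Ah (- (C^T *m Ch) - M *m X *m Mh) in
  let Ph := sylvester Ah Ah^T (Bh *m Bh^T) in
  let Qh := sylvester Ah^T Ah (Ch^T *m Ch + Mh *m Ph *m Mh) in
  \tr (B^T *m Q *m B + 2 *: (B^T *m Y *m Bh) + Bh^T *m Qh *m Bh).

(* Main.v *)
From HB Require Import structures.
Require Import Defs.
From mathcomp Require Import all_boot all_order all_algebra.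
From mathcomp Require Import all_classical all_reals all_analysis.
From mathcomp.real_closed Require Import complex.
From mathcomp Require Import ring lra.
Set Implicit Arguments.
Unset Strict Implicit.
Unset Printing Implicit Defensive.
Import Order.TTheory GRing.Theory Num.Theory.
Import numFieldNormedType.Exports.
Local Open Scope ring_scope.

(** Write [Ah] for [J - R], [<U, V>] for the trace of [U^T V], and [S] for the
Sylvester operator [X |-> F X + X G^T].  All matrices [A], [Ah] are Hurwitz, so
every Sylvester operator that occurs is invertible: a solution of [F X = - X G]
satisfies [p(F) X = X p(-G)] for the characteristic polynomial [p] of [F], which
kills the left side, while [p(-G)] is invertible since the spectra of [F] and
[- G] are disjoint ([sylvester_eq0]).

The adjoint of [S] for the trace pairing is [Y |-> F^T Y + Y G].  Moving it
across the pairing eliminates [Q], [Y] and [Qh] from the cost ([costE]):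
  [f = const - 2 <C^T Ch + M X Mh, X> + <Ch^T Ch + Mh P Mh, P>].
Both brackets have the shape [<E + M X N, X>] with [F X + X G^T + H = 0], so one
derivative computation serves both ([jet_quadratic_output]).  Varying [X] in
[<E + M X N, X>] gives [<E + 2 M X N, dX>].  If [K] solves the adjoint equation
[F^T K + K G = E + 2 M X N], this is [<S^* K, dX> = <K, S dX>], and [S dX] is
known to first order by differentiating the Sylvester equation:
  [S dX = - (dF X + X dG^T + dH)].
Hence no derivative of [X] has to be computed. The only analytic input is that
[dX] is of the order of the displacement, which follows from the boundedness
of the inverse of [S] ([sylvester_increment]). Taking [K] for the first
bracket and [- L] for the second, and using that tangent vectors have skew or
symmetric components, the first-order term is the metric pairing with the
stated gradient ([metric_gradient]).

Two gradients coincide because the differential along the manifold is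
determined on tangent vectors: a symmetric matrix is the difference of the
squares of two symmetric matrices, and adding a positive multiple of such a
square to a positive definite matrix keeps it positive definite, so every
tangent vector is a difference of two directions whose whole ray stays in the
manifold ([differential_unique]). The metric is nondegenerate since [xi |->
(xi_J, R xi_R R, xi_B, xi_C, xi_M)] turns it into the Euclidean pairing
([metric_nondegenerate]). *)

(** * Hurwitz matrices and Sylvester equations *)

Lemma symmetricmxP (R : fieldType) (r : nat) (S : 'M[R]_r) :
  reflect (S^T = S) (S \is symmetricmx).
Proof.
by apply: (iffP (is_hermitianmxP _ _ _)); rewrite expr0 scale1r map_mx_id.
Qed.

Lemma skewmxP (R : fieldType) (r : nat) (S : 'M[R]_r) :
  reflect (S^T = - S) (S \is skewmx).
Proof.
apply: (iffP (is_hermitianmxP _ _ _)); rewrite expr1 map_mx_id // scaleN1r.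
  by move=> {2}->; rewrite opprK.
by move=> ->; rewrite opprK.
Qed.

Lemma horner_mx_intertwine (F : comNzRingType) (p q : nat) (A : 'M[F]_p.+1)
    (G : 'M[F]_q.+1) (X : 'M[F]_(p.+1, q.+1)) (f : {poly F}) :
  A *m X = X *m G -> horner_mx A f *m X = X *m horner_mx G f.
Proof.
move=> AX; elim/poly_ind: f => [|f c IH].
  by rewrite !rmorph0 mul0mx mulmx0.
rewrite !rmorphD !rmorphM /= !horner_mx_X !horner_mx_C mulmxDl mulmxDr.
rewrite -!mulmxE -mulmxA AX mulmxA IH -mulmxA.
by rewrite mul_scalar_mx mul_mx_scalar.
Qed.

Lemma eigenvalueN_unitmx (F : fieldType) (n : nat) (A : 'M[F]_n) (a : F) :
  ~~ eigenvalue A a -> A - a%:M \in unitmx.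
Proof. by rewrite /eigenvalue /eigenspace negbK kermx_eq0 row_free_unit. Qed.

(** By Cayley-Hamilton [X *m p(G) = 0] for the characteristic polynomial [p] of
    [A], and [p(G)] is a product of matrices [G - z] with [z] an eigenvalue of
    [A], hence not one of [G]. *)
Lemma intertwine_disjoint_eq0 (F : closedFieldType) (p q : nat) (A : 'M[F]_p)
    (G : 'M[F]_q) (X : 'M[F]_(p, q)) :
  (forall z, eigenvalue A z -> ~~ eigenvalue G z) ->
  A *m X = X *m G -> X = 0.
Proof.
case: p A X => [|p] A X; first by move=> _ _; apply: flatmx0.
case: q G X => [|q] G X; first by move=> _ _; apply: thinmx0.
move=> dis AX.
have [s chA] := closed_field_poly_normal (char_poly A).
have eqX : X *m horner_mx G (char_poly A) = 0.
  by rewrite -(horner_mx_intertwine _ AX) Cayley_Hamilton mul0mx.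
suff u : horner_mx G (char_poly A) \in unitmx.
  by rewrite -[X]mulmx1 -(mulmxV u) mulmxA eqX mul0mx.
rewrite (monicP (char_poly_monic A)) scale1r in chA.
have roots z : z \in s -> eigenvalue A z.
  by rewrite eigenvalue_root_char chA root_prod_XsubC.
rewrite chA; elim: s roots {chA} => [|z s IH] roots.
  by rewrite big_nil rmorph1 unitmx1.
rewrite big_cons rmorphM /= -mulmxE unitmx_mul; apply/andP; split.
  rewrite rmorphB /= horner_mx_X horner_mx_C; apply: eigenvalueN_unitmx.
  by apply: dis; apply: roots; rewrite mem_head.
by apply: IH => w ws; apply: roots; rewrite inE ws orbT.
Qed.

Lemma hurwitz_trmx (R : realType) (n : nat) (A : 'M[R]_n) :
  hurwitz A -> hurwitz A^T.
Proof.
move=> hA z; rewrite eigenvalue_root_char -map_trmx.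
have -> : char_poly (map_mx (real_complex R) A)^T
        = char_poly (map_mx (real_complex R) A).
  rewrite /char_poly /char_poly_mx -det_tr; congr (\det _).
  by rewrite linearB /= tr_scalar_mx -map_trmx trmxK.
by rewrite -eigenvalue_root_char; apply: hA.
Qed.

Lemma sylvester_eq0 (R : realType) (p q : nat) (F : 'M[R]_p) (G : 'M[R]_q)
    (X : 'M[R]_(p, q)) :
  hurwitz F -> hurwitz G -> F *m X + X *m G = 0 -> X = 0.
Proof.
move=> hF hG /eqP; rewrite addr_eq0 -mulmxN => /eqP FX.
apply: (map_mx_inj (f := real_complex R)); rewrite map_mx0.
apply: (intertwine_disjoint_eq0 (A := map_mx (real_complex R) F)
  (G := map_mx (real_complex R) (- G))); last by rewrite -!map_mxM FX.
move=> z /hF z_lt0; apply/negP => /eigenvalueP[v vG v0].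
have /hG : eigenvalue (map_mx (real_complex R) G) (- z).
  apply/eigenvalueP; exists v => //.
  by rewrite scaleNr -vG map_mxN mulmxN opprK.
by rewrite raddfN oppr_lt0 => /(lt_trans z_lt0); rewrite ltxx.
Qed.

(** The matrix of the Sylvester operator acting on row vectors through [mxvec];
    it turns injectivity of the operator into bijectivity and bounds its
    inverse. *)
Definition sylvmx (R : realType) (p q : nat) (F : 'M[R]_p) (G : 'M[R]_q) :
  'M[R]_(p * q) := lin_mx (mulmx F) + lin_mx (mulmxr G).

Lemma mul_sylvmx (R : realType) (p q : nat) (F : 'M[R]_p) (G : 'M[R]_q) X :
  mxvec X *m sylvmx F G = mxvec (F *m X + X *m G).
Proof. by rewrite mulmxDr !mul_vec_lin -raddfD. Qed.

Lemma sylvmx_unit (R : realType) (p q : nat) (F : 'M[R]_p) (G : 'M[R]_q) :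
  hurwitz F -> hurwitz G -> sylvmx F G \in unitmx.
Proof.
move=> hF hG; rewrite -row_free_unit; apply: inj_row_free => v.
rewrite -[v]vec_mxK mul_sylvmx => /eqP; rewrite mxvec_eq0 => /eqP eq0.
by rewrite (sylvester_eq0 hF hG eq0) linear0.
Qed.

Lemma sylvester_uniq (R : realType) (p q : nat) (F : 'M[R]_p) (G : 'M[R]_q) H
    (X Y : 'M[R]_(p, q)) : hurwitz F -> hurwitz G ->
  F *m X + X *m G + H = 0 -> F *m Y + Y *m G + H = 0 -> X = Y.
Proof.
move=> hF hG eX eY; apply/eqP; rewrite -subr_eq0; apply/eqP.
apply: (sylvester_eq0 hF hG).
by rewrite mulmxBr mulmxBl addrACA -opprD -(addrKA H) eX [H + _]addrC eY subr0.
Qed.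

Lemma sylvesterP (R : realType) (p q : nat) (F : 'M[R]_p) (G : 'M[R]_q) H :
  hurwitz F -> hurwitz G ->
  F *m sylvester F G H + sylvester F G H *m G + H = 0.
Proof.
move=> hF hG.
apply: (@xgetPex _ 0 [set X | F *m X + X *m G + H = 0]%classic).
exists (vec_mx (mxvec (- H) *m invmx (sylvmx F G))).
rewrite /= -[X in X + H]mxvecK -mul_sylvmx vec_mxK mulmxKV ?sylvmx_unit //.
by rewrite mxvecK addNr.
Qed.

Lemma unique_sylvester (R : realType) (p q : nat) (F : 'M[R]_p) (G : 'M[R]_q) H :
  hurwitz F -> hurwitz G ->
  unique (fun X => F *m X + X *m G + H = 0) (sylvester F G H).
Proof.
move=> hF hG; split; first exact: sylvesterP.
by move=> Y; apply: sylvester_uniq => //; apply: sylvesterP.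
Qed.

(** The transpose of a solution solves the same equation. *)
Lemma sylvester_sym (R : realType) (q : nat) (F W L : 'M[R]_q) :
  hurwitz F -> W^T = W -> F^T *m L + L *m F + W = 0 -> L^T = L.
Proof.
move=> hF sW eqL; apply: (sylvester_uniq (hurwitz_trmx hF) hF _ eqL).
have /(congr1 trmx) := eqL; rewrite linear0 !linearD /= !trmx_mul !trmxK sW => <-.
by rewrite [in LHS](addrC (F^T *m _)).
Qed.

(** * Trace identities *)

Lemma mxtrace_sqrE (R : realDomainType) (p q : nat) (X : 'M[R]_(p, q)) :
  \tr (X^T *m X) = \sum_j \sum_i X i j ^+ 2.
Proof.
by apply: eq_bigr => j _; rewrite mxE; apply: eq_bigr => i _; rewrite mxE expr2.
Qed.

Lemma mxtrace_sqr_ge0 (R : realDomainType) (p q : nat) (X : 'M[R]_(p, q)) :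
  0 <= \tr (X^T *m X).
Proof.
by rewrite mxtrace_sqrE; do 2!apply: sumr_ge0 => ? _; apply: sqr_ge0.
Qed.

Lemma mxtrace_sqr_eq0 (R : realDomainType) (p q : nat) (X : 'M[R]_(p, q)) :
  (\tr (X^T *m X) == 0) = (X == 0).
Proof.
apply/idP/eqP => [|->]; last by rewrite mulmx0 mxtrace0.
rewrite mxtrace_sqrE psumr_eq0 => [/allP/= X0|j _]; last first.
  by apply: sumr_ge0 => ? _; apply: sqr_ge0.
apply/matrixP => i j; rewrite mxE; apply/eqP; rewrite -sqrf_eq0.
have := X0 j (mem_index_enum _); rewrite psumr_eq0 => [/allP/= Xj|k _].
  exact: (Xj i (mem_index_enum _)).
exact: sqr_ge0.
Qed.

(** The operator [K |-> F^T K + K G^T] is the adjoint of [Z |-> F Z + Z G] for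
    the trace pairing. *)
Lemma mxtrace_sylvester_adj (R : comNzRingType) p q (F : 'M[R]_p) (G : 'M[R]_q)
    (K Z : 'M[R]_(p, q)) :
  \tr (K^T *m (F *m Z + Z *m G)) = \tr ((F^T *m K + K *m G^T)^T *m Z).
Proof.
rewrite mulmxDr linearD /= [in RHS]linearD /= mulmxDl [in RHS]linearD /=.
rewrite !trmx_mul !trmxK -mulmxA; congr (_ + _).
by rewrite mulmxA mxtrace_mulC -mulmxA.
Qed.

Lemma mxtrace_congr_adj (R : comNzRingType) p q (M : 'M[R]_p) (N : 'M[R]_q)
    (X Z : 'M[R]_(p, q)) : M^T = M -> N^T = N ->
  \tr ((M *m Z *m N)^T *m X) = \tr ((M *m X *m N)^T *m Z).
Proof.
move=> sM sN; rewrite -mxtrace_tr !trmx_mul !trmxK sM sN.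
by rewrite !mulmxA [LHS]mxtrace_mulC !mulmxA.
Qed.

(** The two traces are the classical pair of expressions of an H2 norm, through
    the observability and through the controllability Gramian: each equals
    minus the pairing of [Y] with the Sylvester operator applied to [X]. *)
Lemma mxtrace_gramian_duality (R : comNzRingType) p q (F : 'M[R]_p) (G : 'M[R]_q)
    (X Y H W : 'M[R]_(p, q)) :
  F *m X + X *m G^T + H = 0 -> F^T *m Y + Y *m G + W = 0 ->
  \tr (Y^T *m H) = \tr (W^T *m X).
Proof.
move=> /eqP; rewrite addrC addr_eq0 => /eqP ->.
move=> /eqP; rewrite addrC addr_eq0 => /eqP ->.
by rewrite mulmxN raddfN /= mxtrace_sylvester_adj trmxK !raddfN /= mulNmx raddfN.
Qed.

Lemma mxtrace_sandwich (R : comNzRingType) p q s (U : 'M[R]_(p, s))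
    (Y : 'M[R]_(p, q)) (V : 'M[R]_(q, s)) :
  \tr (U^T *m Y *m V) = \tr (Y^T *m (U *m V^T)).
Proof. by rewrite -mxtrace_tr !trmx_mul trmxK mxtrace_mulC -mulmxA. Qed.

(** * Skew matrix minus a positive definite one *)

Lemma mx11_tr (F : comNzRingType) (u : 'M[F]_1) : u^T = u.
Proof. by rewrite [u]mx11_scalar tr_scalar_mx. Qed.

(** If [a + i b] is an eigenvector for the eigenvalue [x + i y], then [x (|a|^2
    + |b|^2)] is the sum of the values at [a] and [b] of the quadratic form of
    [J - S]; the skew part contributes nothing to it. Working with real and
    imaginary parts avoids complex Hermitian forms. *)
Lemma hurwitz_dissipative (R : realType) (r : nat) (J S : 'M[R]_r) :
  J \is skewmx -> posdefmx S -> hurwitz (J - S).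
Proof.
move=> /skewmxP skJ [_ posS] z /eigenvalueP[v vA v0].
pose a : 'rV[R]_r := map_mx (@complex.Re R) v.
pose b : 'rV[R]_r := map_mx (@complex.Im R) v.
case: z vA => x y vA /=.
have aA : a *m (J - S) = x *: a - y *: b.
  apply/rowP => j; have /rowP/(_ j)/(congr1 (@complex.Re R)) := vA.
  rewrite !mxE raddf_sum /=; case: (v _ _) => vr vi /= <-.
  by apply: eq_bigr => i _; rewrite !mxE; case: (v _ _) => ? ? /=; ring.
have bA : b *m (J - S) = x *: b + y *: a.
  apply/rowP => j; have /rowP/(_ j)/(congr1 (@complex.Im R)) := vA.
  rewrite !mxE raddf_sum /=; case: (v _ _) => vr vi /= <-.
  by apply: eq_bigr => i _; rewrite !mxE; case: (v _ _) => ? ? /=; ring.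
have skw (u : 'rV[R]_r) : u *m (J - S) *m u^T = - (u *m S *m u^T).
  rewrite mulmxBr mulmxBl; suff -> : u *m J *m u^T = 0 by rewrite sub0r.
  have := mx11_tr (u *m J *m u^T).
  rewrite !trmx_mul trmxK skJ mulNmx mulmxN mulmxA => /eqP.
  by rewrite eq_sym -addr_eq0 -mulr2n -scaler_nat scaler_eq0 pnatr_eq0 => /eqP.
have Sge0 (u : 'rV[R]_r) : 0 <= (u *m S *m u^T) 0 0.
  have [->|u0] := eqVneq u 0; first by rewrite !mul0mx mxE.
  by have := posS u^T; rewrite trmx_eq0 trmxK => /(_ u0)/ltW.
have Sgt0 : 0 < (a *m S *m a^T) 0 0 + (b *m S *m b^T) 0 0.
  have [a0|a0] := eqVneq a 0; last first.
    apply: ltr_pwDl (Sge0 b).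
    by have := posS a^T; rewrite trmx_eq0 trmxK; apply.
  apply: ltr_wpDl (Sge0 a) _; have := posS b^T.
  rewrite trmx_eq0 trmxK; apply; apply: contra_neq v0 => b0.
  apply/rowP => j; rewrite mxE; have /rowP/(_ j) := a0; have /rowP/(_ j) := b0.
  by rewrite !mxE; case: (v _ _) => ? ? /= -> ->.
(* The terms in [y] cancel because the 1 x 1 matrix [b *m a^T] is symmetric. *)
have key : x *: (a *m a^T + b *m b^T) = - (a *m S *m a^T + b *m S *m b^T).
  rewrite opprD -!skw aA bA mulmxBl mulmxDl -!scalemxAl.
  rewrite -[b *m a^T]mx11_tr trmx_mul trmxK addrACA addNr addr0.
  by rewrite scalerDr.
have n_ge0 (u : 'rV[R]_r) : 0 <= (u *m u^T) 0 0.
  by have := mxtrace_sqr_ge0 u^T; rewrite trmxK /mxtrace big_ord1.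
have {key} : x * ((a *m a^T) 0 0 + (b *m b^T) 0 0)
  = - ((a *m S *m a^T) 0 0 + (b *m S *m b^T) 0 0).
  have ev (k : R) (U V U' V' : 'M[R]_1) :
      k *: (U + V) = - (U' + V') -> k * (U 0 0 + V 0 0) = - (U' 0 0 + V' 0 0).
    by move=> /matrixP/(_ 0 0); rewrite !mxE.
  exact: ev key.
move: (n_ge0 a) (n_ge0 b) Sgt0.
set p := (a *m a^T) _ _; set q := (b *m b^T) _ _.
set s := _ + (_ *m b^T) _ _ => p0 q0 s0 eqx.
rewrite ltNge; apply/negP => x0.
suff : 0 <= - s by rewrite oppr_ge0 leNgt s0.
by rewrite -eqx mulr_ge0 // addr_ge0.
Qed.

(** * Norm estimates *)

Section MatrixNorm.
Context {R : realType}.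

Lemma mx_norm_ge_entry p q (U : 'M[R]_(p, q)) i j : `|U i j| <= `|U|.
Proof.
by rewrite [leRHS]/Num.Def.normr /= mx_normrE; apply: (le_bigmax _ _ (i, j)).
Qed.

Lemma mx_norm_le p q (U : 'M[R]_(p, q)) c :
  0 <= c -> (forall i j, `|U i j| <= c) -> `|U| <= c.
Proof.
move=> c0 Uc; rewrite [leLHS]/Num.Def.normr /= mx_normrE.
by apply: bigmax_le => // -[i j] _; apply: Uc.
Qed.

Lemma mx_norm_mulmx p q s (U : 'M[R]_(p, q)) (V : 'M[R]_(q, s)) :
  `|U *m V| <= q%:R * (`|U| * `|V|).
Proof.
apply: mx_norm_le => [|i j]; first by rewrite !mulr_ge0.
rewrite mxE; apply: le_trans (ler_norm_sum _ _ _) _.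
have -> : q%:R * (`|U| * `|V|) = \sum_(k < q) `|U| * `|V|.
  by rewrite sumr_const card_ord mulr_natl.
apply: ler_sum => k _.
by rewrite normrM ler_pM // mx_norm_ge_entry.
Qed.

Lemma mx_norm_trmx p q (U : 'M[R]_(p, q)) : `|U^T| <= `|U|.
Proof. by apply: mx_norm_le => // i j; rewrite mxE mx_norm_ge_entry. Qed.

Lemma norm_mxtrace p (U : 'M[R]_p) : `|\tr U| <= p%:R * `|U|.
Proof.
apply: le_trans (ler_norm_sum _ _ _) _.
have -> : p%:R * `|U| = \sum_(k < p) `|U|.
  by rewrite sumr_const card_ord mulr_natl.
apply: ler_sum => k _.
exact: mx_norm_ge_entry.
Qed.

Lemma mx_norm_mxvec p q (U : 'M[R]_(p, q)) : `|mxvec U| <= `|U|.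
Proof.
apply: mx_norm_le => // i j; rewrite ord1; case/mxvec_indexP: j => k l.
by rewrite mxvecE mx_norm_ge_entry.
Qed.

Lemma mx_norm_vec_mx p q (u : 'rV[R]_(p * q)) : `|vec_mx u| <= `|u|.
Proof. by apply: mx_norm_le => // i j; rewrite mxE mx_norm_ge_entry. Qed.

Lemma sylvester_bounded p q (F : 'M[R]_p) (G : 'M[R]_q) :
  hurwitz F -> hurwitz G ->
  exists2 c, 0 <= c & forall X, `|X| <= c * `|F *m X + X *m G|.
Proof.
move=> hF hG; exists ((p * q)%:R * `|invmx (sylvmx F G)|).
  by rewrite mulr_ge0.
move=> X; rewrite -{1}[X]mxvecK -[mxvec X](mulmxK (sylvmx_unit hF hG)).
rewrite mul_sylvmx; apply: le_trans (mx_norm_vec_mx _) _.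
apply: le_trans (mx_norm_mulmx _ _) _.
by rewrite -mulrA ler_wpM2l // mulrC ler_wpM2l // mx_norm_mxvec.
Qed.

End MatrixNorm.

(** * First-order expansions *)

(** Estimates along a filter [G] in terms of a nonnegative size [rho] tending
    to zero; below, [G] is the trace on the manifold of the neighbourhoods of a
    point [x] and [rho] is the distance to [x]. *)
Section FirstOrder.
Context {R : realType} {T : Type} (G : set_system T) {FG : Filter G}.
Variable rho : T -> R.
Hypothesis rho_ge0 : forall y, 0 <= rho y.
Hypothesis rho_to0 : forall e, 0 < e -> \forall y \near G, rho y <= e.

(** [F] is big-O of [rho ^+ k]; the constant and the exponent are kept explicit
    so that products of matrices of different sizes add exponents. *)
Definition ord {V : normedModType R} (k : nat) (F : T -> V) : Prop :=
  exists2 c, 0 <= c & \forall y \near G, `|F y| <= c * rho y ^+ k.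

Lemma ord_near {V : normedModType R} k (F H : T -> V) :
  ord k F -> (\forall y \near G, F y = H y) -> ord k H.
Proof.
move=> [c c0 Fc] FH; exists c => //.
by apply: filterS2 FH Fc => y <-.
Qed.

Lemma ord_cst {V : normedModType R} (v : V) : ord 0 (fun=> v).
Proof.
by exists `|v| => //; apply: filterE => y; rewrite expr0 mulr1.
Qed.

Lemma ord_zero {V : normedModType R} k : ord k (fun=> 0 : V).
Proof. by exists 0 => //; apply: filterE => y; rewrite normr0 mul0r. Qed.

Lemma ordD {V : normedModType R} k (F H : T -> V) :
  ord k F -> ord k H -> ord k (fun y => F y + H y).
Proof.
move=> [c c0 Fc] [d d0 Hd]; exists (c + d); first exact: addr_ge0.
apply: filterS2 Fc Hd => y Fy Hy.
by rewrite mulrDl; apply: le_trans (ler_normD _ _) _; apply: lerD.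
Qed.

Lemma ordZ {V : normedModType R} k a (F : T -> V) :
  ord k F -> ord k (fun y => a *: F y).
Proof.
move=> [c c0 Fc]; exists (`|a| * c); first exact: mulr_ge0.
by apply: filterS Fc => y Fy; rewrite normrZ -mulrA ler_wpM2l.
Qed.

Lemma ordN {V : normedModType R} k (F : T -> V) :
  ord k F -> ord k (fun y => - F y).
Proof.
by move=> [c c0 Fc]; exists c => //; apply: filterS Fc => y; rewrite normrN.
Qed.

Lemma ordB {V : normedModType R} k (F H : T -> V) :
  ord k F -> ord k H -> ord k (fun y => F y - H y).
Proof. by move=> rF rH; apply: ordD => //; apply: ordN. Qed.

Lemma ordW {V : normedModType R} k l (F : T -> V) :
  (k <= l)%N -> ord l F -> ord k F.
Proof.
move=> kl [c c0 Fc]; exists c => //.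
apply: filterS2 Fc (rho_to0 ltr01) => y Fy r1.
by apply: le_trans Fy _; rewrite ler_wpM2l // ler_wiXn2l.
Qed.

Lemma ordM p q s k l (F : T -> 'M[R]_(p, q)) (H : T -> 'M[R]_(q, s)) :
  ord k F -> ord l H -> ord (k + l) (fun y => F y *m H y).
Proof.
move=> [c c0 Fc] [d d0 Hd]; exists (q%:R * (c * d)); first by rewrite !mulr_ge0.
apply: filterS2 Fc Hd => y Fy Hy; apply: le_trans (mx_norm_mulmx _ _) _.
by rewrite exprD -mulrA ler_wpM2l // mulrACA ler_pM.
Qed.

Lemma ord_trmx p q k (F : T -> 'M[R]_(p, q)) :
  ord k F -> ord k (fun y => (F y)^T).
Proof.
move=> [c c0 Fc]; exists c => //; apply: filterS Fc => y.
exact: le_trans (mx_norm_trmx _).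
Qed.

Lemma ord_mxtrace p k (F : T -> 'M[R]_p) :
  ord k F -> ord k (fun y => \tr (F y) : R^o).
Proof.
move=> [c c0 Fc]; exists (p%:R * c); first exact: mulr_ge0.
apply: filterS Fc => y Fy; apply: le_trans (norm_mxtrace _) _.
by rewrite -mulrA ler_wpM2l.
Qed.

(** [F = F0 + F1 + O(rho^2)] with [F1 = O(rho)]. The first-order part [F1] is
    an arbitrary function of the point, only determined up to [O(rho^2)]; this
    allows the increment of an implicitly defined function to serve as its own
    first-order part before its derivative is known. *)
Definition jet {V : normedModType R} (F : T -> V) (F0 : V) (F1 : T -> V) :=
  ord 1 F1 /\ ord 2 (fun y => F y - F0 - F1 y).

Lemma jet_increment {V : normedModType R} (F : T -> V) F0 F1 :
  jet F F0 F1 -> ord 1 (fun y => F y - F0).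
Proof.
move=> [dF /(ordW (leqnSn 1)) rF]; apply: (ord_near (ordD dF rF)).
by apply: filterE => y; rewrite addrC subrK.
Qed.

Lemma jet_bounded {V : normedModType R} (F : T -> V) F0 F1 :
  jet F F0 F1 -> ord 0 F.
Proof.
move=> /jet_increment/(ordW (leq0n 1)) incr.
apply: (ord_near (ordD incr (ord_cst F0))).
by apply: filterE => y; rewrite subrK.
Qed.

Lemma jet_exact {V : normedModType R} (F : T -> V) F0 :
  ord 1 (fun y => F y - F0) -> jet F F0 (fun y => F y - F0).
Proof.
move=> incr; split=> //; apply: (ord_near (ord_zero 2)).
by apply: filterE => y; rewrite subrr.
Qed.

Lemma jet_cst {V : normedModType R} (v : V) : jet (fun=> v) v (fun=> 0).
Proof.
split; first exact: ord_zero.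
by apply: (ord_near (ord_zero 2)); apply: filterE => y; rewrite subrr subr0.
Qed.

(** Uniqueness of expansions: this is how an equation is differentiated. *)
Lemma jet_vanishing {V : normedModType R} (F : T -> V) F1 :
  (\forall y \near G, F y = 0) -> jet F 0 F1 -> ord 2 F1.
Proof.
move=> F0 [_ /ordN rem]; apply: (ord_near rem).
by apply: filterS F0 => y ->; rewrite subr0 sub0r opprK.
Qed.

Lemma jetD {V : normedModType R} (F H : T -> V) F0 F1 H0 H1 :
  jet F F0 F1 -> jet H H0 H1 ->
  jet (fun y => F y + H y) (F0 + H0) (fun y => F1 y + H1 y).
Proof.
move=> [dF rF] [dH rH]; split; first exact: ordD.
apply: (ord_near (ordD rF rH)); apply: filterE => y.
by rewrite !opprD (addrACA (F y) (H y)) (addrACA (F y - F0) (H y - H0)).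
Qed.

Lemma jetZ {V : normedModType R} a (F : T -> V) F0 F1 :
  jet F F0 F1 -> jet (fun y => a *: F y) (a *: F0) (fun y => a *: F1 y).
Proof.
move=> [dF rF]; split; first exact: ordZ.
by apply: (ord_near (ordZ a rF)); apply: filterE => y; rewrite !scalerBr.
Qed.

Lemma jetN {V : normedModType R} (F : T -> V) F0 F1 :
  jet F F0 F1 -> jet (fun y => - F y) (- F0) (fun y => - F1 y).
Proof.
move=> [dF rF]; split; first exact: ordN.
by apply: (ord_near (ordN rF)); apply: filterE => y; rewrite !opprD.
Qed.

Lemma jetM p q s (F : T -> 'M[R]_(p, q)) (H : T -> 'M[R]_(q, s)) F0 F1 H0 H1 :
  jet F F0 F1 -> jet H H0 H1 ->
  jet (fun y => F y *m H y) (F0 *m H0) (fun y => F1 y *m H0 + F0 *m H1 y).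
Proof.
move=> jF jH; have [dF rF] := jF; have [dH rH] := jH; split.
  by apply: ordD; [apply: (ordM dF (ord_cst _)) | apply: (ordM (ord_cst _) dH)].
have rem : ord 2 (fun y => (F y - F0 - F1 y) *m H y + F1 y *m (H y - H0)
                         + F0 *m (H y - H0 - H1 y)).
  apply: ordD; first apply: ordD.
  - exact: (ordM rF (jet_bounded jH)).
  - exact: (ordM dF (jet_increment jH)).
  - exact: (ordM (ord_cst _) rH).
apply: (ord_near rem); apply: filterE => y.
rewrite !mulmxBl !mulmxBr.
move: (F y *m H y) (F0 *m H y) (F1 y *m H y) (F1 y *m H0) (F0 *m H0) (F0 *m H1 y).
by move=> a b c d e f; apply/matrixP => i j; rewrite !mxE; ring.
Qed.

Lemma jet_trmx p q (F : T -> 'M[R]_(p, q)) F0 F1 :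
  jet F F0 F1 -> jet (fun y => (F y)^T) F0^T (fun y => (F1 y)^T).
Proof.
move=> [dF rF]; split; first exact: ord_trmx.
by apply: (ord_near (ord_trmx rF)); apply: filterE => y; rewrite !linearB.
Qed.

Lemma jet_mxtrace p (F : T -> 'M[R]_p) F0 F1 : jet F F0 F1 ->
  jet (fun y => \tr (F y) : R^o) (\tr F0) (fun y => \tr (F1 y)).
Proof.
move=> [dF rF]; split; first exact: ord_mxtrace.
by apply: (ord_near (ord_mxtrace rF)); apply: filterE => y; rewrite !linearB.
Qed.

Lemma jet_mod {V : normedModType R} (F : T -> V) F0 F1 H1 :
  jet F F0 F1 -> ord 2 (fun y => F1 y - H1 y) -> jet F F0 H1.
Proof.
move=> [dF rF] FH; split.
  apply: (ord_near (ordB dF (ordW (leqnSn 1) FH))).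
  by apply: filterE => y; rewrite subKr.
by apply: (ord_near (ordD rF FH)); apply: filterE => y; rewrite addrA subrK.
Qed.

Lemma jet_near {V : normedModType R} (F H : T -> V) F0 F1 :
  jet F F0 F1 -> (\forall y \near G, F y = H y) -> jet H F0 F1.
Proof.
move=> [dF rF] FH; split=> //; apply: (ord_near rF).
by apply: filterS FH => y ->.
Qed.

(** The inverse of the unperturbed operator bounds [Z] by [c |W|] plus a small
    multiple of [|Z|], which is absorbed in the left-hand side. *)
Lemma ord_sylvester p q (F : 'M[R]_p) (G0 : 'M[R]_q)
    (Z W : T -> 'M[R]_(p, q)) (f : T -> 'M[R]_p) (g : T -> 'M[R]_q) :
  hurwitz F -> hurwitz G0 -> ord 1 W -> ord 1 f -> ord 1 g ->
  (\forall y \near G,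
     F *m Z y + Z y *m G0 = W y + f y *m Z y + Z y *m g y) ->
  ord 1 Z.
Proof.
move=> hF hG [w w0 Ww] [a a0 fa] [b b0 gb] eqZ.
have [c c0 Zc] := sylvester_bounded hF hG.
(* [k * rho] is the operator norm of the small terms; it is at most 1/2 once
   [rho <= 1 / (2 k + 1)], where the added 1 keeps the denominator positive. *)
pose k := c * (p%:R * a + q%:R * b).
have k0 : 0 <= k by rewrite mulr_ge0 // addr_ge0 // mulr_ge0.
have k1 : 0 < 2 * k + 1 by rewrite ltr_wpDl // mulr_ge0.
exists (2 * (c * w)); first by rewrite !mulr_ge0.
have small : \forall y \near G, rho y <= (2 * k + 1)^-1.
  by apply: rho_to0; rewrite invr_gt0.
near=> y; rewrite expr1.
have kr : k * rho y <= 2^-1.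
  have : (2 * k + 1) * rho y <= 1 by rewrite -ler_pdivlMl // mulr1; near: y.
  have := rho_ge0 y; lra.
have Wy : `|W y| <= w * rho y by rewrite -[rho y]expr1; near: y.
have fy : `|f y| <= a * rho y by rewrite -[rho y]expr1; near: y.
have gy : `|g y| <= b * rho y by rewrite -[rho y]expr1; near: y.
have eqy : F *m Z y + Z y *m G0 = W y + f y *m Z y + Z y *m g y by near: y.
have Zy : `|Z y| <= c * (w * rho y) + k * rho y * `|Z y|.
  apply: le_trans (Zc _) _; rewrite eqy /k -!mulrA -mulrDr ler_wpM2l //.
  apply: le_trans (ler_normD _ _) _; rewrite mulrDl addrA; apply: lerD.
    apply: le_trans (ler_normD _ _) _; apply: lerD => //.
    apply: le_trans (mx_norm_mulmx _ _) _.
    by rewrite -mulrA ler_wpM2l // mulrA ler_wpM2r.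
  apply: le_trans (mx_norm_mulmx _ _) _.
  by rewrite -mulrA ler_wpM2l // [leRHS]mulrA mulrC ler_wpM2r.
have := ler_wpM2r (normr_ge0 (Z y)) kr; lra.
Unshelve. all: by end_near.
Qed.

Section QuadraticOutput.
Variables (p q : nat).
Variables (F : T -> 'M[R]_p) (F0 : 'M[R]_p) (F1 : T -> 'M[R]_p).
Variables (N : T -> 'M[R]_q) (N0 : 'M[R]_q) (N1 : T -> 'M[R]_q).
Variables (A : T -> 'M[R]_q) (A0 : 'M[R]_q) (A1 : T -> 'M[R]_q).
Variables (M : T -> 'M[R]_p) (M0 : 'M[R]_p) (M1 : T -> 'M[R]_p).
Variables (H : T -> 'M[R]_(p, q)) (H0 : 'M[R]_(p, q)) (H1 : T -> 'M[R]_(p, q)).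
Variables (E : T -> 'M[R]_(p, q)) (E0 : 'M[R]_(p, q)) (E1 : T -> 'M[R]_(p, q)).
Hypotheses (jF : jet F F0 F1) (jN : jet N N0 N1) (jA : jet A A0 A1).
Hypotheses (jM : jet M M0 M1) (jH : jet H H0 H1) (jE : jet E E0 E1).
Hypotheses (hF : hurwitz F0) (hA : hurwitz A0).
Hypotheses (M0_sym : M0^T = M0) (N0_sym : N0^T = N0).
Variables (X : T -> 'M[R]_(p, q)) (X0 : 'M[R]_(p, q)).
Hypothesis eqX : \forall y \near G, F y *m X y + X y *m (A y)^T + H y = 0.
Hypothesis eqX0 : F0 *m X0 + X0 *m A0^T + H0 = 0.

(** Subtracting the equations at the two points shows that the increment solves
    a Sylvester equation with the unperturbed operator, a right-hand side of
    first order, and terms in which the increment is multiplied by a small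
    matrix. *)
Lemma sylvester_increment : ord 1 (fun y => X y - X0).
Proof.
pose f y : 'M[R]_p := F0 - F y; pose g y : 'M[R]_q := A0^T - (A y)^T.
have df : ord 1 f.
  apply: (ord_near (ordN (jet_increment jF))).
  by apply: filterE => y; rewrite opprB.
have dg : ord 1 g.
  apply: (ord_near (ordN (ord_trmx (jet_increment jA)))).
  by apply: filterE => y; rewrite linearB /= opprB.
pose W y : 'M[R]_(p, q) := f y *m X0 + X0 *m g y + (H0 - H y).
have dW : ord 1 W.
  apply: ordD; first apply: ordD.
  - exact: (ordM df (ord_cst _)).
  - exact: (ordM (ord_cst _) dg).
  - apply: (ord_near (ordN (jet_increment jH))).
    by apply: filterE => y; rewrite opprB.
apply: (ord_sylvester hF (hurwitz_trmx hA) dW df dg).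
apply: filterS eqX => y eqy.
rewrite /W; have -> : H0 - H y
    = (F y *m X y + X y *m (A y)^T) - (F0 *m X0 + X0 *m A0^T).
  move: eqy eqX0 => /eqP; rewrite addr_eq0 => /eqP -> /eqP.
  by rewrite addr_eq0 => /eqP ->; rewrite opprK addrC.
rewrite /f /g !mulmxBl !mulmxBr.
move: (F0 *m X y) (F0 *m X0) (F y *m X y) (F y *m X0) => a b c d.
move: (X y *m A0^T) (X0 *m A0^T) (X y *m (A y)^T) (X0 *m (A y)^T) => a' b' c' d'.
by apply/matrixP => i j; rewrite !mxE; ring.
Qed.

(** The increment [Z] of [X] enters the first-order part given by the product
    rule through [<E0 + 2 M0 X0 N0, Z> = <F0^T K + K A0, Z>]. By adjointness
    this pairs [K] with the Sylvester operator at [Z], which the differentiated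
    equation expresses by the increments of the data up to second order. *)
Lemma jet_quadratic_output (K : 'M[R]_(p, q)) :
  F0^T *m K + K *m A0 = E0 + 2 *: (M0 *m X0 *m N0) ->
  jet (fun y => \tr ((E y + M y *m X y *m N y)^T *m X y) : R^o)
    (\tr ((E0 + M0 *m X0 *m N0)^T *m X0))
    (fun y => \tr ((E1 y)^T *m X0)
      + \tr ((M1 y *m X0 *m N0 + M0 *m X0 *m N1 y)^T *m X0)
      - \tr (K^T *m (F1 y *m X0 + X0 *m (A1 y)^T + H1 y))).
Proof.
move=> eqK; have jX := jet_exact sylvester_increment.
(* The Sylvester equation, expanded to first order. *)
have jS := jetD (jetD (jetM jF jX) (jetM jX (jet_trmx jA))) jH.
rewrite eqX0 in jS; have oS := jet_vanishing eqX jS.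
have jW := jetD jE (jetM (jetM jM jX) jN).
apply: (jet_mod (jet_mxtrace (jetM (jet_trmx jW) jX))).
apply: (ord_near (ord_mxtrace (ordM (ord_cst K^T) oS))); apply: filterE => y.
move: (X y - X0) => Z.
have -> : F1 y *m X0 + F0 *m Z + (Z *m A0^T + X0 *m (A1 y)^T) + H1 y
  = (F0 *m Z + Z *m A0^T) + (F1 y *m X0 + X0 *m (A1 y)^T + H1 y).
  by rewrite [F1 y *m X0 + F0 *m Z]addrC [in LHS]addrACA [RHS]addrA.
rewrite mulmxDr linearD /= mxtrace_sylvester_adj trmxK eqK.
rewrite !(mulmxDl, raddfD, linearZ) /=.
rewrite [(2 *: _)^T]linearZ -scalemxAl [\tr (2 *: _)]linearZ /=.
rewrite (mxtrace_congr_adj X0 Z M0_sym N0_sym); ring.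
Qed.

End QuadraticOutput.

End FirstOrder.

(** * The metric and uniqueness of gradients *)

Section Coordinates.
Context {R : realType} {r m : nat}.
Implicit Types (x y z g xi : params R r m).

Lemma norm_Jpart z : `|Jpart z| <= `|z|.
Proof. by rewrite !prod_normE /= !le_max lexx. Qed.

Lemma norm_Rpart z : `|Rpart z| <= `|z|.
Proof. by rewrite !prod_normE /= !le_max lexx !orbT. Qed.

Lemma norm_Bpart z : `|Bpart z| <= `|z|.
Proof. by rewrite !prod_normE /= !le_max lexx !orbT. Qed.

Lemma norm_Cpart z : `|Cpart z| <= `|z|.
Proof. by rewrite !prod_normE /= !le_max lexx !orbT. Qed.

Lemma norm_Mpart z : `|Mpart z| <= `|z|.
Proof. by rewrite !prod_normE /= !le_max lexx !orbT. Qed.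

Lemma metric_linear x g : linear (metric x g : params R r m -> R^o).
Proof.
move=> a u v; rewrite /metric.
have -> : Jpart (a *: u + v) = a *: Jpart u + Jpart v by [].
have -> : Rpart (a *: u + v) = a *: Rpart u + Rpart v by [].
have -> : Bpart (a *: u + v) = a *: Bpart u + Bpart v by [].
have -> : Cpart (a *: u + v) = a *: Cpart u + Cpart v by [].
have -> : Mpart (a *: u + v) = a *: Mpart u + Mpart v by [].
rewrite !(mulmxDr, linearD, raddfD) /= -!scalemxAr ?linearZ /=.
by rewrite /GRing.scale /=; ring.
Qed.

Lemma metricBl x g h xi : metric x (g - h) xi = metric x g xi - metric x h xi.
Proof.
rewrite /metric.
have -> : Jpart (g - h) = Jpart g - Jpart h by [].
have -> : Rpart (g - h) = Rpart g - Rpart h by [].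
have -> : Bpart (g - h) = Bpart g - Bpart h by [].
have -> : Cpart (g - h) = Cpart g - Cpart h by [].
have -> : Mpart (g - h) = Mpart g - Mpart h by [].
rewrite ![(_ - _)^T]linearB /= !(mulmxBl, mulmxBr) ![\tr (_ - _)]linearB /=.
by ring.
Qed.

Lemma metricZl x g a xi : metric x (a *: g) xi = a * metric x g xi.
Proof.
rewrite /metric.
have -> : Jpart (a *: g) = a *: Jpart g by [].
have -> : Rpart (a *: g) = a *: Rpart g by [].
have -> : Bpart (a *: g) = a *: Bpart g by [].
have -> : Cpart (a *: g) = a *: Cpart g by [].
have -> : Mpart (a *: g) = a *: Mpart g by [].
rewrite ![(a *: _)^T]linearZ /= -!scalemxAr -!scalemxAl !linearZ /=.
by ring.
Qed.

Lemma congruence_sym p q (U : 'M[R]_(p, q)) (S : 'M[R]_q) :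
  S^T = S -> (U *m S *m U^T)^T = U *m S *m U^T.
Proof. by move=> sS; rewrite !trmx_mul trmxK sS mulmxA. Qed.

Lemma tangentB g h : tangent g -> tangent h -> tangent (g - h).
Proof.
move=> [/skewmxP gJ /symmetricmxP gR /symmetricmxP gM].
move=> [/skewmxP hJ /symmetricmxP hR /symmetricmxP hM].
have -> : g - h = (Jpart g - Jpart h, Rpart g - Rpart h, Bpart g - Bpart h,
                   Cpart g - Cpart h, Mpart g - Mpart h) by [].
by split; [apply/skewmxP | apply/symmetricmxP | apply/symmetricmxP];
  rewrite /= linearB /= ?gJ ?hJ ?gR ?hR ?gM ?hM // opprB opprK addrC.
Qed.

Lemma manifold_tangent x : manifold x -> tangent x.
Proof. by move=> [? [? _] ?]. Qed.

Lemma posdefmx_unit (S : 'M[R]_r) : posdefmx S -> S \in unitmx.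
Proof.
move=> [_ posS]; rewrite -unitmx_tr -row_free_unit; apply: inj_row_free => v vS.
apply: contraTeq isT => v0; have := posS v^T; rewrite trmx_eq0 trmxK => /(_ v0).
by rewrite -mulmxA -[S *m _]trmxK trmx_mul trmxK vS trmx0 mulmx0 mxE ltxx.
Qed.

(** Testing against [(J, S R S, B, C, N)], where [S] is the positive definite
    component of [x] and the other letters are the components of [g], yields
    the sum of the squared Euclidean norms of the components of [g]. *)
Lemma metric_nondegenerate x g : manifold x -> tangent g ->
  (forall xi, tangent xi -> metric x g xi = 0) -> g = 0.
Proof.
move=> [_ posR _] [gJ /symmetricmxP gR gM] g0.
have Runit := posdefmx_unit posR; case: posR => /symmetricmxP sR _.
pose S := Rpart x; pose xi : params R r m :=
  (Jpart g, S *m Rpart g *m S, Bpart g, Cpart g, Mpart g).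
have /g0 : tangent xi.
  split=> //; apply/symmetricmxP.
  by have := congruence_sym S gR; rewrite sR.
rewrite /metric /= -/S.
have -> : \tr (invmx S *m Rpart g *m invmx S *m (S *m Rpart g *m S))
    = \tr ((Rpart g)^T *m Rpart g).
  by rewrite gR -!mulmxA mulKmx // mxtrace_mulC -!mulmxA mulmxV // mulmx1.
have -> : \tr (Cpart g *m (Cpart g)^T) = \tr (((Cpart g)^T)^T *m (Cpart g)^T).
  by rewrite trmxK.
have ge0 := @mxtrace_sqr_ge0 R.
move/eqP; rewrite !paddr_eq0 ?addr_ge0 ?ge0 // !mxtrace_sqr_eq0 trmx_eq0.
case: g {gJ gR gM g0 xi} => [[[[a b] c] d] e].
rewrite /Jpart /Rpart /Bpart /Cpart /Mpart /=.
by do 4!case/andP; do 5!move=> /eqP ->.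
Qed.

(** Dividing the two first-order estimates by the parameter of the ray. *)
Lemma differential_unique_direction (f : params R r m -> R) x xi
    (D D' : {linear params R r m -> R^o}) :
  is_differential f x D -> is_differential f x D' ->
  (forall t : R, 0 < t -> manifold (x + t *: xi)) -> D xi = D' xi.
Proof.
move=> [_ dD] [_ dD'] xmf; apply/eqP; rewrite -subr_eq0 -normr_le0.
apply/ler_addgt0Pr => e e0; rewrite add0r.
have k0 : 0 < 2 * (`|xi| + 1) by rewrite mulr_gt0 // ltr_wpDl.
pose e' := e / (2 * (`|xi| + 1)); have e'0 : 0 < e' by rewrite divr_gt0.
have near_x := dD _ e'0; have near_x' := dD' _ e'0.
rewrite !near_withinE in near_x near_x'.
have /nbhs_normP[d /= d0 xd] :=
  @filterI _ _ (nbhs_filter x) _ _ near_x near_x'.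
(* [d] is the radius on which both estimates hold, so the point at parameter [t]
   is within reach, and the two errors add up to at most [e * t]. *)
pose t := d / (2 * (`|xi| + 1)); have t0 : 0 < t by rewrite divr_gt0.
have tx : x + t *: xi - x = t *: xi by rewrite addrC addKr.
have linE (L : {linear params R r m -> R^o}) : L (t *: xi) = t * L xi.
  by rewrite linearZ.
have small : `|x - (x + t *: xi)| < d.
  rewrite distrC tx normrZ gtr0_norm // /t -mulrA -[ltRHS]mulr1 ltr_pM2l // mulrC.
  rewrite ltr_pdivrMr // mul1r; have := normr_ge0 xi; lra.
have [/(_ (xmf _ t0)) + /(_ (xmf _ t0))] := xd _ small.
rewrite tx !linE normrZ (gtr0_norm t0) => le1 le2.
have le12 : t * `|D xi - D' xi| <= t * (2 * e' * `|xi|).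
  rewrite -{1}(gtr0_norm t0) -normrM mulrBr.
  have := ler_normB (f (x + t *: xi) - f x - t * D' xi)
    (f (x + t *: xi) - f x - t * D xi).
  have -> : f (x + t *: xi) - f x - t * D' xi - (f (x + t *: xi) - f x - t * D xi)
    = t * D xi - t * D' xi by ring.
  move=> le3.
  by apply: le_trans le3 _; move: le1 le2; lra.
rewrite ler_pM2l // in le12; apply: le_trans le12 _.
have -> : e = e' * (2 * (`|xi| + 1)) by rewrite divfK ?gt_eqF.
have := e'0; lra.
Qed.

(** [U *m U] is positive semidefinite, being [U^T *m U]. *)
Lemma posdefmxD_sqr (S U : 'M[R]_r) (t : R) :
  posdefmx S -> U^T = U -> 0 < t -> posdefmx (S + t *: (U *m U)).
Proof.
move=> [/symmetricmxP sS posS] sU t0; split=> [|v v0].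
  by apply/symmetricmxP; rewrite linearD linearZ /= trmx_mul sS sU.
have -> : v^T *m (S + t *: (U *m U)) *m v
    = v^T *m S *m v + t *: ((U *m v)^T *m (U *m v)).
  by rewrite mulmxDr mulmxDl -scalemxAr -scalemxAl trmx_mul sU !mulmxA.
have ev (V W : 'M[R]_1) : (V + t *: W) 0 0 = V 0 0 + t * W 0 0 by rewrite !mxE.
rewrite ev; apply: ltr_pwDl; first exact: posS.
apply: mulr_ge0; first exact: ltW.
by have := mxtrace_sqr_ge0 (U *m v); rewrite /mxtrace big_ord1.
Qed.

Lemma manifold_ray x (J : 'M[R]_r) (U : 'M[R]_r) b c (N : 'M[R]_r) (t : R) :
  manifold x -> J \is skewmx -> U^T = U -> N \is symmetricmx -> 0 < t ->
  manifold (x + t *: (J, U *m U, b, c, N)).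
Proof.
move=> [/skewmxP xJ xR /symmetricmxP xM] /skewmxP sJ sU /symmetricmxP sN t0.
split.
- have -> : Jpart (x + t *: (J, U *m U, b, c, N)) = Jpart x + t *: J by [].
  by apply/skewmxP; rewrite linearD linearZ /= xJ sJ opprD scalerN.
- exact: posdefmxD_sqr.
- have -> : Mpart (x + t *: (J, U *m U, b, c, N)) = Mpart x + t *: N by [].
  by apply/symmetricmxP; rewrite linearD linearZ /= xM sN.
Qed.

(** With [U = (S + 1) / 2] and [V = (S - 1) / 2] one has [S = U^2 - V^2], so a
    tangent vector is a difference of two directions to which [manifold_ray]
    applies. This replaces the openness of the positive definite cone. *)
Lemma differential_unique (f : params R r m -> R) x
    (D D' : {linear params R r m -> R^o}) :
  manifold x -> is_differential f x D -> is_differential f x D' ->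
  forall xi, tangent xi -> D xi = D' xi.
Proof.
move=> xM dD dD' [[[[J S] b] c] N] [/= sJ /symmetricmxP sS sN].
pose U := 2^-1 *: (S + 1%:M); pose V := 2^-1 *: (S - 1%:M).
have sU : U^T = U by rewrite linearZ linearD /= trmx1 sS.
have sV : V^T = V by rewrite linearZ linearB /= trmx1 sS.
have -> : (J, S, b, c, N) = (J, U *m U, b, c, N) - (0, V *m V, 0, 0, 0)
    :> params R r m.
  suff -> : S = U *m U - V *m V by congr (_, _, _, _, _); rewrite ?subr0.
  rewrite /U /V -!scalemxAl -!scalemxAr !(mulmxDl, mulmxDr).
  rewrite !(mulmxN, mulNmx, mulmx1, mul1mx) opprK.
  move: (S *m S) (1%:M : 'M[R]_r) => SS I1.
  by apply/matrixP => i j; rewrite !mxE; field.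
rewrite !raddfB; congr (_ - _).
  by apply: (differential_unique_direction dD dD') => t; apply: manifold_ray.
apply: (differential_unique_direction dD dD') => t.
by apply: manifold_ray => //; [apply/skewmxP | apply/symmetricmxP];
  rewrite linear0 ?oppr0.
Qed.

Lemma gradient_unique (f : params R r m -> R) x g h :
  manifold x -> is_gradient f x g -> is_gradient f x h -> g = h.
Proof.
move=> xM [tg [D dD Dg]] [th [D' dD' Dh]].
apply/eqP; rewrite -subr_eq0; apply/eqP.
apply: (metric_nondegenerate xM (tangentB tg th)) => xi txi.
by rewrite metricBl -Dg // -Dh // (differential_unique xM dD dD') ?subrr.
Qed.

Lemma near_manifold_small x (e : R) : 0 < e ->
  \forall y \near within manifold (nbhs x), `|y - x| <= e.
Proof.
move=> e0; apply: cvg_within.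
apply: (iffRL (nbhs_normP x (fun y => `|y - x| <= e))); exists e => // y /=.
by rewrite distrC => /ltW.
Qed.

Definition jetx x {V : normedModType R} (F : params R r m -> V) :=
  jet (within manifold (nbhs x)) (fun y => `|y - x|) F.

Lemma jetx_part x {V : normedModType R} (part : params R r m -> V) :
  (forall y, part (y - x) = part y - part x) ->
  (forall z, `|part z| <= `|z|) ->
  jetx x part (part x) (fun y => part (y - x)).
Proof.
move=> partB part_le; split.
  by exists 1 => //; apply: filterE => y; rewrite mul1r expr1.
exists 0 => //; apply: filterE => y.
by rewrite partB subrr normr0 mul0r.
Qed.

(** The candidate differential; the pairing with a gradient makes sense for
    every ambient vector, so it extends the differential from the tangent
    space. *)
Definition metric_dual x g : {linear params R r m -> R^o} :=
  HB.pack (metric x g : params R r m -> R^o)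
    (GRing.isLinear.Build R (params R r m) R^o *:%R _ (metric_linear x g)).

Lemma metric_bounded x g :
  exists2 c, 0 <= c & forall z, `|metric x g z| <= c * `|z|.
Proof.
have bd p q (W : 'M[R]_(p, q)) (part : params R r m -> 'M[R]_(q, p)) :
    (forall z, `|part z| <= `|z|) ->
    exists2 c, 0 <= c & forall z, `|\tr (W *m part z)| <= c * `|z|.
  move=> part_le; exists (p%:R * (q%:R * `|W|)); first by rewrite !mulr_ge0.
  move=> z; apply: le_trans (norm_mxtrace _) _.
  rewrite -!mulrA ler_wpM2l //; apply: le_trans (mx_norm_mulmx _ _) _.
  by rewrite !ler_wpM2l.
have [a a0 Ja] := bd _ _ (Jpart g)^T _ norm_Jpart.
have [b b0 Rb] :=
  bd _ _ (invmx (Rpart x) *m Rpart g *m invmx (Rpart x)) _ norm_Rpart.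
have [c c0 Bc] := bd _ _ (Bpart g)^T _ norm_Bpart.
have [d d0 Cd] := bd _ _ (Cpart g) (fun z => (Cpart z)^T)
  (fun z => le_trans (mx_norm_trmx _) (norm_Cpart z)).
have [e e0 Me] := bd _ _ (Mpart g)^T _ norm_Mpart.
exists (a + b + c + d + e) => [|z]; first by rewrite !addr_ge0.
by rewrite !mulrDl; do 4!(apply: le_trans (ler_normD _ _) _; apply: lerD => //).
Qed.

Lemma metric_continuous x g : continuous (metric_dual x g).
Proof.
have [c c0 bound] := metric_bounded x g.
apply/linear_bounded_continuous/linear_boundedP; near=> k => z.
apply: le_trans (bound z) _; rewrite ler_wpM2r //.
Unshelve. all: by end_near.
Qed.

Lemma jetx_differential x (f : params R r m -> R) g :
  jetx x (f : params R r m -> R^o) (f x) (fun y => metric x g (y - x)) ->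
  exists2 D : {linear params R r m -> R^o}, is_differential f x D &
    forall xi, tangent xi -> D xi = metric x g xi.
Proof.
move=> [_ [c c0 rem]].
exists (metric_dual x g) => //; split; first exact: metric_continuous.
move=> e e0; have c1 : 0 < c + 1 by rewrite ltr_wpDl.
have small := near_manifold_small x (divr_gt0 e0 c1).
apply: filterS2 rem small => y le1 le2; apply: le_trans le1 _.
rewrite expr2 mulrA ler_wpM2r //.
rewrite ler_pdivlMr // in le2; have := normr_ge0 (y - x); lra.
Qed.

End Coordinates.

(** * The cost function *)

Lemma hurwitz_reduced (R : realType) r m (y : params R r m) :
  manifold y -> hurwitz (Jpart y - Rpart y).
Proof. by move=> [yJ yR _]; apply: hurwitz_dissipative. Qed.

Section Cost.
Context {R : realType} {n r m : nat}.
Variables (A : 'M[R]_n) (B : 'M[R]_(n, m)) (C : 'rV[R]_n) (M : 'M[R]_n).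
Hypothesis A_hurwitz : hurwitz A.
Implicit Types (x y : params R r m).

Definition drift y := Jpart y - Rpart y.
Definition cross_gramian y := sylvester A (drift y)^T (B *m (Bpart y)^T).
Definition gramian y := sylvester (drift y) (drift y)^T (Bpart y *m (Bpart y)^T).

Lemma cross_gramianP y : manifold y ->
  A *m cross_gramian y + cross_gramian y *m (drift y)^T + B *m (Bpart y)^T = 0.
Proof.
by move=> /hurwitz_reduced/hurwitz_trmx hy; exact: (sylvesterP _ A_hurwitz hy).
Qed.

Lemma gramianP y : manifold y ->
  drift y *m gramian y + gramian y *m (drift y)^T + Bpart y *m (Bpart y)^T = 0.
Proof.
by move=> /hurwitz_reduced hy; exact: (sylvesterP _ hy (hurwitz_trmx hy)).
Qed.

(** Each of the last two terms of the cost is moved by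
    [mxtrace_gramian_duality] from the solution of the observability equation
    to that of the controllability equation; the constant is the term that only
    involves the full system. *)
Lemma costE : exists c0, forall y, manifold y ->
  cost A B C M y = c0
    - 2 * \tr ((C^T *m Cpart y + M *m cross_gramian y *m Mpart y)^T
                *m cross_gramian y)
    + \tr (((Cpart y)^T *m Cpart y + Mpart y *m gramian y *m Mpart y)^T
            *m gramian y).
Proof.
eexists => y ym; rewrite /cost -/(drift y) -/(cross_gramian y) -/(gramian y).
have hA := hurwitz_trmx A_hurwitz; have hy := hurwitz_reduced ym.
rewrite -(opprD (C^T *m Cpart y)) !mxtraceD mxtraceZ !mxtrace_sandwich.
set Y := sylvester _ (drift y) (- _); set Q := sylvester _ (drift y) _.
have eqY := sylvesterP (- (C^T *m Cpart y + M *m cross_gramian y *m Mpart y))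
              hA hy.
have eqQ := sylvesterP ((Cpart y)^T *m Cpart y + Mpart y *m gramian y *m Mpart y)
              (hurwitz_trmx hy) hy.
rewrite (mxtrace_gramian_duality (cross_gramianP ym) eqY).
rewrite (mxtrace_gramian_duality (gramianP ym) eqQ).
rewrite [(- _)^T]linearN mulNmx [\tr (- _)]linearN /= mulrN; reflexivity.
Qed.

Lemma gramian_sym y : manifold y -> (gramian y)^T = gramian y.
Proof.
move=> ym; have hy := hurwitz_trmx (hurwitz_reduced ym).
apply: (sylvester_sym (W := Bpart y *m (Bpart y)^T) hy).
  by rewrite trmx_mul trmxK.
by rewrite trmxK; apply: gramianP.
Qed.

(** Skewness or symmetry of the components of [xi] lets [skewpart] and
    [sympart] be dropped from the pairing, and the two congruences by [Rpart x]
    and its inverse cancel; the symmetry of [P] and [L] merges equal terms into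
    the factor 2. *)
Lemma metric_gradient x xi X P K L :
  manifold x -> tangent xi -> M^T = M -> P^T = P -> L^T = L ->
  metric x
      (2 *: (skewpart (K^T *m X + L *m P),
             - (Rpart x *m sympart (K^T *m X + L *m P) *m Rpart x),
             K^T *m B + L *m Bpart x,
             Cpart x *m P - C *m X,
             P *m Mpart x *m P - X^T *m M *m X)) xi
  = - 2 * (\tr ((C^T *m Cpart xi)^T *m X) + \tr ((M *m X *m Mpart xi)^T *m X)
           - \tr (K^T *m (X *m (drift xi)^T + B *m (Bpart xi)^T)))
    + (\tr (((Cpart xi)^T *m Cpart x + (Cpart x)^T *m Cpart xi)^T *m P)
       + \tr ((Mpart xi *m P *m Mpart x + Mpart x *m P *m Mpart xi)^T *m P)
       + \tr (L^T *m (drift xi *m P + P *m (drift xi)^T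
           + (Bpart xi *m (Bpart x)^T + Bpart x *m (Bpart xi)^T)))).
Proof.
move=> [_ posR /symmetricmxP sM'] [/skewmxP sJ /symmetricmxP sR /symmetricmxP sM].
move=> sMM sP sL.
have Ru := posdefmx_unit posR.
have dual p q (U : 'M[R]_(p, q)) (V : 'M[R]_(p, q)) :
    \tr (U *m V^T) = \tr (U^T *m V).
  by rewrite -mxtrace_tr trmx_mul trmxK mxtrace_mulC.
rewrite metricZl /metric.
set G := K^T *m X + L *m P.
have -> : \tr ((skewpart G)^T *m Jpart xi) = \tr (G^T *m Jpart xi).
  rewrite /skewpart linearZ linearB /= trmxK -scalemxAl mxtraceZ mulmxBl.
  have := dual _ _ G (Jpart xi); rewrite sJ mulmxN linearB linearN /= => <-.
  by field.
have -> : \tr (invmx (Rpart x) *m - (Rpart x *m sympart G *m Rpart x)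
    *m invmx (Rpart x) *m Rpart xi) = - \tr (G^T *m Rpart xi).
  rewrite mulmxN !mulNmx linearN /= -!mulmxA mulKmx // mulKVmx //.
  rewrite /sympart -scalemxAl mxtraceZ mulmxDl.
  have := dual _ _ G (Rpart xi); rewrite sR mxtraceD => <-.
  by congr (- _); field.
have -> : \tr ((C^T *m Cpart xi)^T *m X) = \tr (C *m X *m (Cpart xi)^T).
  by rewrite trmx_mul trmxK -[_ *m C *m X]mulmxA mxtrace_mulC.
have -> : \tr ((M *m X *m Mpart xi)^T *m X)
    = \tr ((X^T *m M *m X)^T *m Mpart xi).
  by rewrite !trmx_mul trmxK sM sMM -!mulmxA mxtrace_mulC -!mulmxA.
have -> : \tr (K^T *m (X *m (drift xi)^T + B *m (Bpart xi)^T))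
    = \tr ((K^T *m X)^T *m drift xi) + \tr ((K^T *m B)^T *m Bpart xi).
  by rewrite mulmxDr mxtraceD !mulmxA !dual.
have -> : \tr (((Cpart xi)^T *m Cpart x + (Cpart x)^T *m Cpart xi)^T *m P)
    = 2 * \tr (Cpart x *m P *m (Cpart xi)^T).
  have e1 : \tr ((Cpart x)^T *m Cpart xi *m P)
      = \tr (Cpart x *m P *m (Cpart xi)^T).
    by rewrite -mxtrace_tr !trmx_mul trmxK sP mulmxA mxtrace_mulC mulmxA.
  have e2 : \tr ((Cpart xi)^T *m Cpart x *m P)
      = \tr (Cpart x *m P *m (Cpart xi)^T).
    by rewrite -[_ *m Cpart x *m P]mulmxA mxtrace_mulC.
  by rewrite linearD /= !trmx_mul !trmxK mulmxDl mxtraceD e1 e2; ring.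
have -> : \tr ((Mpart xi *m P *m Mpart x + Mpart x *m P *m Mpart xi)^T *m P)
    = 2 * \tr ((P *m Mpart x *m P)^T *m Mpart xi).
  rewrite linearD /= !trmx_mul sM sM' sP mulmxDl mxtraceD -!mulmxA.
  rewrite (mxtrace_mulC (Mpart xi)) !mulmxA.
  by rewrite [X in X + _]mxtrace_mulC !mulmxA; ring.
have -> : \tr (L^T *m (drift xi *m P + P *m (drift xi)^T
      + (Bpart xi *m (Bpart x)^T + Bpart x *m (Bpart xi)^T)))
    = 2 * \tr ((L *m P)^T *m drift xi) + 2 * \tr ((L *m Bpart x)^T *m Bpart xi).
  move: (drift xi) => a; rewrite sL !mulmxDr !mxtraceD !mulmxA.
  rewrite (dual _ _ (L *m P)) (dual _ _ (L *m Bpart x)).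
  rewrite (mxtrace_mulC _ P) (mxtrace_mulC _ (Bpart x)^T) !mulmxA.
  rewrite !trmx_mul sL sP; ring.
rewrite /drift /G /Bpart /Cpart /Mpart /=.
rewrite ![(_ + _)^T]linearD /= ![(- _)^T]linearN /=.
rewrite !(mulmxDl, mulmxBr, mulmxBl) !(mxtraceD, raddfB).
by rewrite !mulNmx ![\tr (- _)]linearN /=; ring.
Qed.

(** [jet_quadratic_output] for the pairs [(A, drift)] with multiplier [K] and
    [(drift, drift)] with multiplier [- L]. The sign is that of the
    inhomogeneity in the equation for [L]. *)
Lemma jetx_cost x (K : 'M[R]_(n, r)) (L : 'M[R]_r) :
  manifold x -> M^T = M ->
  A^T *m K + K *m drift x - C^T *m Cpart x
    - 2 *: (M *m cross_gramian x *m Mpart x) = 0 ->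
  (drift x)^T *m L + L *m drift x + (Cpart x)^T *m Cpart x
    + 2 *: (Mpart x *m gramian x *m Mpart x) = 0 ->
  jetx x (cost A B C M : params R r m -> R^o) (cost A B C M x)
    (fun y => metric x
      (2 *: (skewpart (K^T *m cross_gramian x + L *m gramian x),
             - (Rpart x *m sympart (K^T *m cross_gramian x + L *m gramian x)
                *m Rpart x),
             K^T *m B + L *m Bpart x,
             Cpart x *m gramian x - C *m cross_gramian x,
             gramian x *m Mpart x *m gramian x
               - (cross_gramian x)^T *m M *m cross_gramian x))
      (y - x)).
Proof.
move=> xM M_sym eqK eqL.
have rho_ge0 (y : params R r m) : 0 <= `|y - x| by [].
have rho_to0 := near_manifold_small x.
have [_ _ /symmetricmxP Mh_sym] := xM.
have hAh := hurwitz_reduced xM.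
have jJ := jetx_part (x := x) (part := Jpart) (fun=> erefl) norm_Jpart.
have jR := jetx_part (x := x) (part := Rpart) (fun=> erefl) norm_Rpart.
have jB := jetx_part (x := x) (part := Bpart) (fun=> erefl) norm_Bpart.
have jC := jetx_part (x := x) (part := Cpart) (fun=> erefl) norm_Cpart.
have jM := jetx_part (x := x) (part := Mpart) (fun=> erefl) norm_Mpart.
have jA : jetx x drift (drift x) (fun y => drift (y - x)).
  exact: jetD jJ (jetN jR).
have jcst p q (V : 'M[R]_(p, q)) : jetx x (fun=> V) V (fun=> 0).
  exact: jet_cst.
have nearM : \forall y \near within manifold (nbhs x), manifold y.
  exact: near_withinT.
pose proof (jet_quadratic_output rho_ge0 rho_to0 (jcst _ _ A) jM jA (jcst _ _ M)
  (jetM rho_ge0 rho_to0 (jcst _ _ B) (jet_trmx jB))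
  (jetM rho_ge0 rho_to0 (jcst _ _ C^T) jC) A_hurwitz hAh M_sym Mh_sym
  (filterS cross_gramianP nearM) (cross_gramianP xM) (K := K)) as j1.
pose proof (jet_quadratic_output rho_ge0 rho_to0 jA jM jA jM
  (jetM rho_ge0 rho_to0 jB (jet_trmx jB))
  (jetM rho_ge0 rho_to0 (jet_trmx jC) jC) hAh hAh Mh_sym Mh_sym
  (filterS gramianP nearM) (gramianP xM) (K := - L)) as j2.
have eqK' : A^T *m K + K *m drift x
    = C^T *m Cpart x + 2 *: (M *m cross_gramian x *m Mpart x).
  by apply/eqP; rewrite -subr_eq0 opprD addrA eqK.
have eqL' : (drift x)^T *m - L + - L *m drift x
    = (Cpart x)^T *m Cpart x + 2 *: (Mpart x *m gramian x *m Mpart x).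
  apply/eqP; rewrite mulmxN mulNmx -opprD eq_sym -addr_eq0 addrC.
  by rewrite addrA eqL.
have sL : L^T = L.
  apply: (sylvester_sym (W := (Cpart x)^T *m Cpart x
    + 2 *: (Mpart x *m gramian x *m Mpart x)) hAh); last by rewrite addrA.
  rewrite linearD linearZ /= !trmx_mul trmxK Mh_sym (gramian_sym xM).
  by rewrite mulmxA.
have [c0 costE] := costE.
pose proof (jetD (jetD (jet_cst _ (c0 : R^o)) (jetZ (- 2) (j1 eqK')))
  (j2 eqL')) as jc.
have cost0 := costE x xM; rewrite -mulNr in cost0.
rewrite /jetx cost0.
apply: jet_mod (jet_near jc _) _ => //.
  by apply: filterS nearM => y /costE ->; rewrite -mulNr.
apply: (ord_near (ord_zero _ 2)).
apply: filterS nearM => y ym.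
rewrite metric_gradient // ?gramian_sym //; last first.
  by apply: tangentB; apply: manifold_tangent.
rewrite !mul0mx !add0r linearN /= mulNmx [\tr (- _)]linearN /= opprK.
by rewrite -/(drift _) subrr.
Qed.

End Cost.

Lemma tangent_gradient (R : realType) (n r m : nat) (x : params R r m)
  (Z : 'M[R]_r) (M : 'M[R]_n) (X : 'M[R]_(n, r)) (P : 'M[R]_r) b c :
  manifold x -> M^T = M -> P^T = P ->
  tangent (2 *: (skewpart Z, - (Rpart x *m sympart Z *m Rpart x), b, c,
                 P *m Mpart x *m P - X^T *m M *m X) : params R r m).
Proof.
move=> [_ [/symmetricmxP sR _] /symmetricmxP sMh] sM sP.
have sympart_sym : (sympart Z)^T = sympart Z.
  by rewrite linearZ linearD /= trmxK addrC.
have skewpart_skew : (skewpart Z)^T = - skewpart Z.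
  by rewrite linearZ linearB /= trmxK -scalerN opprB.
split.
- by apply/skewmxP; rewrite [LHS]linearZ /= skewpart_skew scalerN.
- apply/symmetricmxP; rewrite [LHS]linearZ /= linearN /= !trmx_mul.
  by rewrite sR sympart_sym mulmxA.
- apply/symmetricmxP; rewrite [LHS]linearZ /= linearB /= !trmx_mul trmxK.
  by rewrite sM sMh sP !mulmxA.
Qed.

Lemma is_gradient_of_jet (R : realType) (r m : nat) (f : params R r m -> R) x g :
  tangent g ->
  jetx x (f : params R r m -> R^o) (f x) (fun y => metric x g (y - x)) ->
  is_gradient f x g.
Proof. by move=> tg /jetx_differential. Qed.

Theorem theorem1 (R : realType) (n r m : nat)
    (n_gt0 : (0 < n)%N) (r_gt0 : (0 < r)%N) (m_gt0 : (0 < m)%N)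
    (A : 'M[R]_n) (B : 'M[R]_(n, m)) (C : 'rV[R]_n) (M : 'M[R]_n)
    (A_hurwitz : hurwitz A) (M_sym : M = M^T)
    (Jh Rh : 'M[R]_r) (Bh : 'M[R]_(r, m)) (Ch : 'rV[R]_r) (Mh : 'M[R]_r)
    (xh_manifold : manifold (Jh, Rh, Bh, Ch, Mh)) :
  exists (X : 'M[R]_(n, r)) (Ph : 'M[R]_r) (K : 'M[R]_(n, r)) (L : 'M[R]_r),
    [/\ unique (fun X' : 'M[R]_(n, r) =>
          A *m X' + X' *m (Jh - Rh)^T + B *m Bh^T = 0) X,
        unique (fun P' : 'M[R]_r =>
          (Jh - Rh) *m P' + P' *m (Jh - Rh)^T + Bh *m Bh^T = 0) Ph,
        unique (fun K' : 'M[R]_(n, r) =>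
          A^T *m K' + K' *m (Jh - Rh) - C^T *m Ch - 2 *: (M *m X *m Mh) = 0) K,
        unique (fun L' : 'M[R]_r =>
          (Jh - Rh)^T *m L' + L' *m (Jh - Rh) + Ch^T *m Ch
            + 2 *: (Mh *m Ph *m Mh) = 0) L
      & unique (is_gradient (cost A B C M) (Jh, Rh, Bh, Ch, Mh))
          (2 *: (skewpart (K^T *m X + L *m Ph),
                 - (Rh *m sympart (K^T *m X + L *m Ph) *m Rh),
                 K^T *m B + L *m Bh,
                 Ch *m Ph - C *m X,
                 Ph *m Mh *m Ph - X^T *m M *m X))].
Proof.
have hA := hurwitz_reduced xh_manifold; rewrite /Jpart /Rpart /= in hA.
have hAT := hurwitz_trmx hA; have A_hurwitzT := hurwitz_trmx A_hurwitz.
pose x : params R r m := (Jh, Rh, Bh, Ch, Mh).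
pose X := sylvester A (Jh - Rh)^T (B *m Bh^T).
pose Ph := sylvester (Jh - Rh) (Jh - Rh)^T (Bh *m Bh^T).
pose K := sylvester A^T (Jh - Rh) (- (C^T *m Ch) - 2 *: (M *m X *m Mh)).
pose L := sylvester (Jh - Rh)^T (Jh - Rh) (Ch^T *m Ch + 2 *: (Mh *m Ph *m Mh)).
have [eqK uniqK] : unique (fun K' : 'M[R]_(n, r) =>
    A^T *m K' + K' *m (Jh - Rh) - C^T *m Ch - 2 *: (M *m X *m Mh) = 0) K.
  have [eqK uniqK] := unique_sylvester
    (- (C^T *m Ch) - 2 *: (M *m X *m Mh)) A_hurwitzT hA.
  by split=> [|K' eqK']; [rewrite -eqK addrA | apply: uniqK; rewrite -eqK' addrA].
have [eqL uniqL] : unique (fun L' : 'M[R]_r =>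
    (Jh - Rh)^T *m L' + L' *m (Jh - Rh) + Ch^T *m Ch
      + 2 *: (Mh *m Ph *m Mh) = 0) L.
  have [eqL uniqL] := unique_sylvester
    (Ch^T *m Ch + 2 *: (Mh *m Ph *m Mh)) hAT hA.
  by split=> [|L' eqL']; [rewrite -eqL addrA | apply: uniqL; rewrite -eqL' addrA].
exists X, Ph, K, L; split.
- exact: unique_sylvester.
- exact: unique_sylvester.
- by split.
- by split.
set g := 2 *: _; suff grad : is_gradient (cost A B C M) x g.
  by split=> // h; apply: gradient_unique.
apply: is_gradient_of_jet; last exact: (jetx_cost (x := x) A_hurwitz xh_manifold).
apply: (tangent_gradient (x := x)) => //.
exact: (gramian_sym xh_manifold).
Qed.
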